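(* Let $D$ be a (finite or infinite) subset of $\mathbb{Z}_{\ge2}$, and let $\Delta(x)=\sum_{d\in D}\frac{x^d}{d!}$. Then, for every integer $k\ge0$, the generating function of multigraphs of excess $k$ in which every vertex has its degree in $D$ is $$\mathrm{MG}^{(D)}_k(z)=(2k-1)!!\,[x^{2k}]\frac{1}{\left(1-z\frac{\Delta(x)}{x^2/2}\right)^{k+1/2}}.$$
   Context: A multigraph with $n$ vertices and $m$ edges has vertex set $\{1,\dots,n\}$ and edges labelled $1,\dots,m$; each edge is a triple $(v,w,e)$ with $v,w$ vertices (possibly equal; the edge is oriented from $v$ to $w$) and $e$ its label. Loops and multiple edges are allowed; a loop contributes $2$ to the degree of its vertex. The empty multigraph is included. Write $n(G)$, $m(G)$ for the numbers of vertices and edges; the excess is $m(G)-n(G)$. The generating function of the multigraphs of excess $k$ in a family $\mathcal{F}$ is the formal power series $F_k(z)=\sum_{G\in\mathcal{F},\,m(G)-n(G)=k}\frac{1}{2^{m(G)}m(G)!}\frac{z^{n(G)}}{n(G)!}$. $(2k-1)!!=\frac{(2k)!}{2^kk!}$, and $[x^{j}]$ denotes coefficient extraction in formal power series. *)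

(* Defs.v *)
From HB Require Import structures.
From mathcomp Require Import all_boot all_order all_algebra.
From mathcomp Require Import boolp classical_sets.

Set Implicit Arguments.
Unset Strict Implicit.
Unset Printing Implicit Defensive.

Import GRing.Theory.
Local Open Scope ring_scope.

(* A record rather than a bare [nat -> A], which already carries the pointwise
   ring structure. *)
Record fps (A : Type) : Type := FPS { fcoef : nat -> A }.

Notation "{ 'fps' A }" := (fps A) (at level 0, format "{ 'fps'  A }").
Notation "[ 'fps' E | n ]" := (FPS (fun n => E))
  (at level 0, n name, format "[ 'fps'  E  |  n ]").
Notation "f `[ n ]" := (fcoef f n%N) (at level 2, n at level 99, format "f `[ n ]").

Lemma fpsP (A : Type) (f g : {fps A}) : (forall n, f`[n] = g`[n]) <-> f = g.
Proof.
by split=> [|-> //]; case: f g => f [g] /= fg; congr FPS; apply/funext.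
Qed.

HB.instance Definition _ (A : Type) := [isNew for @fcoef A].
HB.instance Definition _ (A : choiceType) := [Choice of {fps A} by <:].

Section Zmodule.
Variable A : zmodType.
Implicit Types f g h : {fps A}.

Let add f g : {fps A} := [fps f`[n] + g`[n] | n].
Let opp f : {fps A} := [fps - f`[n] | n].
Let zero : {fps A} := [fps 0 | n].

Let addA : associative add.
Proof. by move=> f g h; apply/fpsP => n /=; rewrite addrA. Qed.
Let addC : commutative add.
Proof. by move=> f g; apply/fpsP => n /=; rewrite addrC. Qed.
Let add0 : left_id zero add.
Proof. by move=> f; apply/fpsP => n /=; rewrite add0r. Qed.
Let addN : left_inverse zero opp add.
Proof. by move=> f; apply/fpsP => n /=; rewrite addNr. Qed.

HB.instance Definition _ := GRing.isZmodule.Build {fps A} addA addC add0 addN.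

Lemma fcoefD f g n : (f + g)`[n] = f`[n] + g`[n]. Proof. by []. Qed.
Lemma fcoefN f n : (- f)`[n] = - f`[n]. Proof. by []. Qed.
Lemma fcoef0 n : (0 : {fps A})`[n] = 0. Proof. by []. Qed.
End Zmodule.

Section Ring.
Variable A : comNzRingType.
Implicit Types f g h : {fps A}.

Let one : {fps A} := [fps (n == 0%N)%:R | n].
Let mul f g : {fps A} := [fps \sum_(i < n.+1) f`[i] * g`[n - i] | n].

Let trunc n f : {poly A} := \poly_(i < n) f`[i].

Let mul_trunc n f g i : (i < n)%N ->
  (mul f g)`[i] = (trunc n f * trunc n g)`_i.
Proof.
move=> lt_in; rewrite coefM /=; apply: eq_bigr => -[j /=]; rewrite ltnS => le_ji _.
by rewrite !coef_poly (leq_ltn_trans le_ji) // (leq_ltn_trans (leq_subr _ _)).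
Qed.

Let mulC : commutative mul.
Proof.
by move=> f g; apply/fpsP => n; rewrite !(@mul_trunc n.+1) // mulrC.
Qed.

Let mulA : associative mul.
Proof.
move=> f g h; apply/fpsP => n.
have E u v w : (mul u (mul v w))`[n] =
    (trunc n.+1 u * (trunc n.+1 v * trunc n.+1 w))`_n.
  rewrite coefM [LHS]/=; apply: eq_bigr => i _.
  by rewrite coef_poly ltn_ord -mul_trunc // ltnS leq_subr.
by rewrite [mul (mul f g) h]mulC !E mulrA mulrC.
Qed.

Let mul1 : left_id one mul.
Proof.
move=> f; apply/fpsP => n /=; rewrite big_ord_recl /= mul1r subn0.
by rewrite big1 ?addr0 // => i _; rewrite mul0r.
Qed.

Let mulD : left_distributive mul +%R.
Proof.
move=> f g h; apply/fpsP => n /=; rewrite -big_split /=.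
by apply: eq_bigr => i _; rewrite mulrDl.
Qed.

Let oner_neq0 : one != 0.
Proof. by apply/eqP => /fpsP/(_ 0%N)/eqP; rewrite /= oner_eq0. Qed.

HB.instance Definition _ :=
  GRing.Zmodule_isComNzRing.Build {fps A} mulA mulC mul1 mulD oner_neq0.

Lemma fcoef1 n : (1 : {fps A})`[n] = (n == 0%N)%:R. Proof. by []. Qed.
Lemma fcoefM f g n : (f * g)`[n] = \sum_(i < n.+1) f`[i] * g`[n - i].
Proof. by []. Qed.

Let scale (a : A) f : {fps A} := [fps a * f`[n] | n].

Let scaleA a b f : scale a (scale b f) = scale (a * b) f.
Proof. by apply/fpsP => n /=; rewrite mulrA. Qed.
Let scale1 : left_id 1 scale.
Proof. by move=> f; apply/fpsP => n /=; rewrite mul1r. Qed.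
Let scaleDr : right_distributive scale +%R.
Proof. by move=> a f g; apply/fpsP => n /=; rewrite mulrDr. Qed.
Let scaleDl f : {morph scale^~ f : a b / a + b}.
Proof. by move=> a b; apply/fpsP => n /=; rewrite mulrDl. Qed.

HB.instance Definition _ := GRing.Zmodule_isLmodule.Build A {fps A}
  scaleA scale1 scaleDr scaleDl.

Lemma fcoefZ (a : A) f n : (a *: f)`[n] = a * f`[n]. Proof. by []. Qed.

Let scaleAl (a : A) f g : a *: (f * g) = (a *: f) * g.
Proof.
apply/fpsP => n; rewrite fcoefZ !fcoefM big_distrr /=.
by apply: eq_bigr => i _; rewrite mulrA.
Qed.

HB.instance Definition _ :=
  GRing.Lmodule_isLalgebra.Build A {fps A} scaleAl.
HB.instance Definition _ :=
  GRing.Lalgebra_isComAlgebra.Build A {fps A}.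

Definition fpsX : {fps A} := [fps (n == 1%N)%:R | n].

(* f(x) / x^m, for f divisible by x^m. *)
Definition fps_divXn (m : nat) f : {fps A} := [fps f`[n + m] | n].

Lemma fcoefXM f n : (fpsX * f)`[n] = if n is n'.+1 then f`[n'] else 0.
Proof.
rewrite fcoefM; case: n => [|n]; first by rewrite big_ord1 mul0r.
rewrite !big_ord_recl big1 => [|i _]; last by rewrite mul0r.
by rewrite /= mul0r mul1r add0r addr0 subSS subn0.
Qed.

Lemma fps_divXnK m f :
  (forall i, (i < m)%N -> f`[i] = 0) -> fpsX ^+ m * fps_divXn m f = f.
Proof.
move=> f0; apply/fpsP => n; have [lt_nm|/subnK<-] := ltnP n m.
  rewrite f0 //; elim: m {f0} (fps_divXn m f) n lt_nm => // m IHm g [|n] lt_nm.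
    by rewrite exprS -mulrA fcoefXM.
  by rewrite exprS -mulrA fcoefXM IHm.
move: (n - m)%N => p; elim: m p f {f0 n} => [|m IHm] p f; first by rewrite mul1r /= addn0.
rewrite exprS -mulrA addnS fcoefXM.
have -> : fps_divXn m.+1 f = fps_divXn m (fps_divXn 1 f).
  by apply/fpsP => i /=; rewrite addnS addn1.
by rewrite IHm /= addn1.
Qed.
End Ring.

Arguments fpsX {A}.

Section Unit.
Variable A : comUnitRingType.
Implicit Types f g : {fps A}.

Let unit : {pred {fps A}} := fun f => f`[0] \is a GRing.unit.

(* The first n coefficients of 1 / f. *)
Fixpoint fps_inv_seq f n : seq A :=
  if n is n'.+1 then
    let s := fps_inv_seq f n' in
    rcons s ((f`[0])^-1 * ((n' == 0%N)%:R - \sum_(i < n') s`_i * f`[n' - i]))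
  else [::].

Let inv f : {fps A} :=
  if f \in unit then [fps (fps_inv_seq f n.+1)`_n | n] else f.

Let size_inv_seq f n : size (fps_inv_seq f n) = n.
Proof. by elim: n => //= n IHn; rewrite size_rcons IHn. Qed.

Let nth_inv_seq f n i : (i < n)%N ->
  (fps_inv_seq f n)`_i = (fps_inv_seq f i.+1)`_i.
Proof.
elim: n => // n IHn; rewrite ltnS leq_eqVlt => /predU1P[-> //|lt_in].
by rewrite [in LHS]/= nth_rcons size_inv_seq lt_in IHn.
Qed.

Let mulV : {in unit, left_inverse 1 inv *%R}.
Proof.
move=> f Uf; rewrite /inv Uf; apply/fpsP => n.
rewrite fcoefM big_ord_recr /= subnn nth_rcons size_inv_seq ltnn eqxx.
rewrite mulrAC mulVr // mul1r addrC.
apply/eqP; rewrite eq_sym -subr_eq -[X in X - _]/((n == 0%N)%:R).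
apply/eqP; congr (_ - _).
by apply: eq_bigr => i _; rewrite (@nth_inv_seq _ n).
Qed.

Let unitP f g : g * f = 1 -> f \in unit.
Proof.
move=> /fpsP/(_ 0%N); rewrite fcoefM big_ord1 => gf1.
by apply/unitrPr; exists g`[0]; rewrite mulrC.
Qed.

Let inv_out : {in [predC unit], inv =1 id}.
Proof. by move=> f /negPf; rewrite /inv => ->. Qed.

HB.instance Definition _ :=
  GRing.ComNzRing_hasMulInverse.Build {fps A} mulV unitP inv_out.

Lemma fps_unitE f : (f \is a GRing.unit) = (f`[0] \is a GRing.unit).
Proof. by []. Qed.
End Unit.

Definition gbinom (a : rat) (j : nat) : rat :=
  (\prod_(i < j) (a - i%:R)) / (j`!)%:R.

(* f ^ a = \sum_j gbinom a j (f - 1)^j, for f with constant coefficient 1;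
   the terms with j > n do not contribute to the coefficient of index n. *)
Definition fps_pow (A : comAlgType rat) (f : {fps A}) (a : rat) : {fps A} :=
  [fps \sum_(j < n.+1) gbinom a j *: ((f - 1) ^+ j)`[n] | n].

(* A series in x and z is encoded as a series in z whose coefficients are series
   in x. *)
Definition in_x (f : {fps rat}) : {fps {fps rat}} := f%:A.

Definition var_z : {fps {fps rat}} := fpsX.

Definition coef_x (j : nat) (F : {fps {fps rat}}) : {fps rat} :=
  [fps (F`[n])`[j] | n].

(* The vertices are 'I_n, the edge labels 'I_m, and the edge labelled e goes
   from (G e).1 to (G e).2. *)
Definition multigraph (n m : nat) : finType := {ffun 'I_m -> 'I_n * 'I_n}.

Definition degree (n m : nat) (G : multigraph n m) (v : 'I_n) : nat :=
  (#|[set e | (G e).1 == v]| + #|[set e | (G e).2 == v]|)%N.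

Definition mg_family : Type := forall n m : nat, pred (multigraph n m).

(* Multigraphs with n vertices and excess k have n + k edges. *)
Definition mg_gf (F : mg_family) (k : nat) : {fps rat} :=
  [fps \sum_(G : multigraph n (n + k) | F n (n + k)%N G)
         (2 ^+ (n + k) * ((n + k)`!)%:R)^-1 * ((n`!)%:R)^-1 | n].

Definition degrees_in (D : set nat) : mg_family :=
  fun n m G => [forall v, degree G v \in D].

Definition Delta (D : set nat) : {fps rat} :=
  [fps if d \in D then (d`!)%:R^-1 else 0 | d].

(* (2k-1)!!, equal to 1 for k = 0. *)
Definition odd_dfact (k : nat) : rat := ((2 * k)`!)%:R / (2 ^+ k * (k`!)%:R).

(* Delta(x) / (x^2/2) *)
Definition Delta_quot (D : set nat) : {fps rat} := 2 *: fps_divXn 2 (Delta D).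

Lemma Delta_quotK (D : set nat) : (forall d, D d -> (2 <= d)%N) ->
  (2^-1 *: fpsX ^+ 2) * Delta_quot D = Delta D.
Proof.
move=> D_ge2; rewrite -scalerAl -scalerAr scalerA mulVf // scale1r.
rewrite fps_divXnK // => i lt_i2 /=; case: ifP => // /set_mem /D_ge2.
by rewrite leqNgt lt_i2.
Qed.

(* Main.v *)
Require Import Defs.
From mathcomp Require Import all_boot all_order all_algebra.
From mathcomp Require Import boolp classical_sets.
From mathcomp Require Import ring.

(** Both sides are computed coefficient by coefficient in z. Fix n and put
    m = n + k.

    A multigraph with n vertices and m edges is an assignment of the 2m ends
    of its edges to the vertices, so the number of those with degree sequence
    (d_v) is (2m)! / prod_v d_v!. Summing over the sequences with all d_v in D
    gives (2m)! [x^(2m)] Delta^n ([count_degrees_in]). In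
    [sum_multigraph_weight] this is proved for an arbitrary weight on the
    degrees of each vertex, which makes an induction on m possible: removing
    an edge from u to u' shifts the weights of u and u', and shifting the
    weight of a vertex differentiates its exponential generating function, so
    summing over (u, u') differentiates the product of these functions twice,
    by the Leibniz rule.

    On the other side, 1 / (1 - zQ)^a = (1 - zQ)^(-a), because the binomial
    series of exponents a and -a are inverse to each other
    ([binom_seriesN]). With a = k + 1/2 and Q = Delta / (x^2 / 2), the
    coefficient of z^n is (-1)^n binom(-a, n) Q^n, and
    [x^(2k)] Q^n = 2^n [x^(2m)] Delta^n, since 2k + 2n = 2m.

    Both sides are thus multiples of [x^(2m)] Delta^n, with factors
    (2m)! / (2^m m! n!) = (2m-1)!! / n! and
    (2k-1)!! 2^n (-1)^n binom(-k-1/2, n); these agree because the n factors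
    2(k+i)+1, i < n, of the second one lead from (2k-1)!! to (2m-1)!!
    ([odd_dfact_gbinom]). *)

Import GRing.Theory.
Local Open Scope ring_scope.

Section Derivative.
Context {A : comNzRingType}.
Implicit Types f g : {fps A}.

Definition fps_deriv f : {fps A} := [fps f`[n.+1] *+ n.+1 | n].

Lemma fps_derivM f g :
  fps_deriv (f * g) = fps_deriv f * g + f * fps_deriv g.
Proof.
apply/fpsP => n; rewrite fcoefD !fcoefM /= -sumrMnl.
(* Split the factor n+1 of the term of index i as i + (n+1 - i): the first
   part differentiates f, the second one g. *)
rewrite (eq_bigr (fun i : 'I_n.+2 => (f`[i] * g`[n.+1 - i]) *+ i +
    (f`[i] * g`[n.+1 - i]) *+ (n.+1 - i))); last first.
  by move=> i _; rewrite -mulrnDr subnKC // -ltnS.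
rewrite big_split /=; congr (_ + _).
  rewrite big_ord_recl mulr0n add0r; apply: eq_bigr => i _.
  by rewrite mulrnAl.
rewrite big_ord_recr /= subnn mulr0n addr0; apply: eq_bigr => i _.
by rewrite subSn ?mulrnAr // -ltnS.
Qed.

Lemma fps_deriv1 : fps_deriv 1 = 0.
Proof. by apply/fpsP => n; rewrite /= mul0rn. Qed.

Lemma fps_deriv_prod n (F : 'I_n -> {fps A}) :
  fps_deriv (\prod_v F v) =
  \sum_u \prod_v (if v == u then fps_deriv (F v) else F v).
Proof.
elim: n F => [|n IHn] F; first by rewrite !big_ord0 fps_deriv1.
rewrite big_ord_recl fps_derivM IHn [RHS]big_ord_recl mulr_sumr /=.
congr (_ + _).
  by rewrite big_ord_recl eqxx.
by apply: eq_bigr => u _; rewrite big_ord_recl.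
Qed.

Lemma fcoefXn j n : ((fpsX : {fps A}) ^+ j)`[n] = (n == j)%:R.
Proof.
elim: j n => [|j IHj] [|n]; rewrite ?expr0 ?exprS ?fcoefXM ?fcoef1 ?IHj //.
Qed.

Lemma fcoefXnM j f n : (fpsX ^+ j * f)`[n + j] = f`[n].
Proof.
elim: j => [|j IHj]; first by rewrite mul1r addn0.
by rewrite exprS -mulrA addnS fcoefXM.
Qed.
End Derivative.

Lemma fact_neq0 n : n`!%:R != 0 :> rat.
Proof. by rewrite Num.Theory.pnatr_eq0 -lt0n fact_gt0. Qed.

Lemma natrS_neq0 n : n.+1%:R != 0 :> rat.
Proof. by rewrite Num.Theory.pnatr_eq0. Qed.

Section BinomialSeries.

Lemma gbinomS a n : gbinom a n.+1 *+ n.+1 = (a - n%:R) * gbinom a n.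
Proof.
rewrite /gbinom big_ord_recr /= -[LHS]mulr_natr factS natrM.
by field; rewrite fact_neq0 nat1r natrS_neq0.
Qed.

Definition binom_series a : {fps rat} := [fps gbinom a n | n].

(** The differential equation (1 + x) y' = a y of (1 + x)^a. Since 1 + x is
    invertible, it determines the derivative of a product of binomial series
    from the exponents, without any convolution of coefficients. *)
Lemma binom_series_ode a :
  (1 + fpsX) * fps_deriv (binom_series a) = a *: binom_series a.
Proof.
apply/fpsP => n; rewrite mulrDl mul1r fcoefD fcoefXM fcoefZ /= gbinomS.
case: n => [|n]; first by rewrite subr0 addr0.
by rewrite /= -[X in _ + X]mulr_natl -mulrDl subrK.
Qed.

(** The logarithmic derivatives of the two factors are opposite, hence the
    product has derivative 0 and is equal to its constant coefficient. *)
Lemma binom_seriesN a : binom_series a * binom_series (- a) = 1.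
Proof.
have U : (1 + fpsX : {fps rat}) \is a GRing.unit.
  by rewrite fps_unitE fcoefD fcoef1 /= addr0 unitr1.
have d0 : fps_deriv (binom_series a * binom_series (- a)) = 0.
  apply: (mulrI U); rewrite fps_derivM mulrDr mulrA binom_series_ode mulr0.
  rewrite mulrCA binom_series_ode -scalerAl -scalerAr scaleNr.
  by rewrite addrN.
apply/fpsP => -[|n].
  by rewrite fcoefM big_ord1 /= /gbinom !big_ord0 fact0 divr1 mulr1.
move/fpsP/(_ n): d0 => /= /eqP.
by rewrite -[X in X == _]mulr_natr mulf_eq0 (negPf (natrS_neq0 n)) orbF => /eqP->.
Qed.

(** Only the term j = n of the defining sum contributes to the coefficient of
    index n, since (X c)^j is a monomial of degree j. *)
Lemma fps_pow_linear (A : comAlgType rat) (c : A) a :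
  fps_pow (1 + fpsX * c%:A) a = [fps gbinom a n *: c ^+ n | n].
Proof.
apply/fpsP => n; rewrite /= [1 + _ - 1]addrC addKr.
have E j : (((fpsX * c%:A) ^+ j)`[n] : A) = c ^+ j * (n == j)%:R.
  by rewrite -scalerAr mulr1 exprZn fcoefZ fcoefXn.
rewrite big_ord_recr /= E eqxx mulr1 big1 ?add0r // => j _.
by rewrite E gtn_eqF // mulr0 scaler0.
Qed.

(** The coefficient of index n of the product of the two powers is c^n times
    that of the product of the binomial series of exponents a and -a. *)
Lemma fps_pow_linearN (A : comUnitAlgType rat) (c : A) a :
  1 / fps_pow (1 + fpsX * c%:A) a = fps_pow (1 + fpsX * c%:A) (- a).
Proof.
have powK : fps_pow (1 + fpsX * c%:A) a * fps_pow (1 + fpsX * c%:A) (- a) = 1.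
  rewrite !fps_pow_linear; apply/fpsP => n; rewrite fcoefM /=.
  rewrite (eq_bigr (fun i : 'I_n.+1 =>
      (gbinom a i * gbinom (- a) (n - i)) *: c ^+ n)); last first.
    move=> i _; rewrite -scalerAl -scalerAr scalerA -exprD subnKC //.
    by rewrite -ltnS.
  rewrite -scaler_suml -[X in X *: _]/((binom_series a * binom_series (- a))`[n]).
  by rewrite binom_seriesN fcoef1; case: n => [|n]; rewrite ?scale1r ?scale0r.
have U : fps_pow (1 + fpsX * c%:A) a \is a GRing.unit.
  by apply/unitrPr; eexists; exact: powK.
by apply: (mulrI U); rewrite powK mul1r divrr.
Qed.
End BinomialSeries.

Definition egf (w : nat -> rat) : {fps rat} := [fps w n / n`!%:R | n].

(** The weights felt by the rest of a configuration once one half-edge has been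
    attached to u. *)
Definition shift {T : eqType} (u : T) (w : T -> nat -> rat) : T -> nat -> rat :=
  fun v d => w v ((v == u) + d)%N.

Lemma fps_deriv_egf w : fps_deriv (egf w) = egf (fun d => w d.+1).
Proof.
apply/fpsP => n /=; rewrite -mulr_natr factS natrM.
by field; rewrite fact_neq0 nat1r natrS_neq0.
Qed.

Lemma fps_deriv_prod_egf n (w : 'I_n -> nat -> rat) :
  fps_deriv (\prod_v egf (w v)) = \sum_u \prod_v egf (shift u w v).
Proof.
rewrite fps_deriv_prod; apply: eq_bigr => u _; apply: eq_bigr => v _.
by rewrite /shift; case: (v == u); rewrite ?fps_deriv_egf.
Qed.

Lemma big_ffun_recl (T : finType) m (F : {ffun 'I_m.+1 -> T} -> rat) :
  \sum_f F f =
  \sum_(x : T) \sum_(f : {ffun 'I_m -> T})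
    F [ffun i => if unlift ord0 i is Some j then f j else x].
Proof.
rewrite pair_big /=.
rewrite (reindex (fun p : T * {ffun 'I_m -> T} =>
  [ffun i => if unlift ord0 i is Some j then p.2 j else p.1])) //=.
exists (fun f => (f ord0, [ffun i => f (lift ord0 i)])) => [[x f]|f] _ /=.
  congr (_, _); first by rewrite ffunE unlift_none.
  by apply/ffunP => i; rewrite !ffunE liftK.
apply/ffunP => i; rewrite !ffunE.
by case: unliftP => [j ->|->] //; rewrite ffunE.
Qed.

Lemma degreeE n m (G : multigraph n m) v :
  degree G v = (\sum_e (((G e).1 == v) + ((G e).2 == v)))%N.
Proof.
rewrite /degree big_split -!sum1_card /=.
by congr addn; rewrite big_mkcond; apply: eq_bigr => e _; rewrite inE; case: eqP.
Qed.

(** The two half-edges of each edge make a multigraph with m edges the same as a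
    placement of 2m labelled balls into n labelled boxes, and the product of
    exponential generating functions counts these by box sizes. Weights that
    depend on the vertex are needed for the induction on m, because removing an
    edge shifts the weights at its two ends only. *)
Lemma sum_multigraph_weight n m (w : 'I_n -> nat -> rat) :
  \sum_(G : multigraph n m) \prod_v w v (degree G v) =
  (2 * m)`!%:R * (\prod_v egf (w v))`[2 * m].
Proof.
elim: m w => [|m IHm] w.
  have coef0_prod (r : seq 'I_n) :
      (\prod_(v <- r) egf (w v))`[0] = \prod_(v <- r) w v 0%N.
    elim: r => [|v r IHr]; first by rewrite !big_nil.
    by rewrite !big_cons fcoefM big_ord1 IHr /= fact0 divr1.
  rewrite mul1r coef0_prod.
  transitivity (\sum_(G : multigraph n 0) \prod_v w v 0%N).
    apply: eq_bigr => G _; apply: eq_bigr => v _.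
    by rewrite degreeE big_ord0.
  by rewrite sumr_const /multigraph card_ffun card_ord.
have coef_deriv2 (f : {fps rat}) : (2 * m.+1)`!%:R * f`[2 * m.+1] =
    (2 * m)`!%:R * (fps_deriv (fps_deriv f))`[2 * m].
  by rewrite mulnS /= !factS -mulrnA -[X in _ = _ * X]mulr_natr !natrM; ring.
have coef_sum (F : 'I_n -> {fps rat}) i :
    (\sum_u F u)`[i] = \sum_u (F u)`[i].
  by rewrite (big_morph (fun f => f`[i]) (fun f g => fcoefD f g i) (fcoef0 _ i)).
have deriv_sum (F : 'I_n -> {fps rat}) :
    fps_deriv (\sum_u F u) = \sum_u fps_deriv (F u).
  by apply/fpsP => i; rewrite coef_sum /= coef_sum -sumrMnl.
(* Classify the multigraphs by the ends u and u' of the edge of label 0. *)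
transitivity (\sum_u \sum_u'
    (2 * m)`!%:R * (\prod_v egf (shift u' (shift u w) v))`[2 * m]); last first.
  rewrite coef_deriv2 fps_deriv_prod_egf deriv_sum coef_sum mulr_sumr.
  by apply: eq_bigr => u _; rewrite fps_deriv_prod_egf coef_sum mulr_sumr.
rewrite big_ffun_recl [RHS]pair_bigA; apply: eq_bigr => -[u u'] _ /=.
rewrite -IHm; apply: eq_bigr => G _; apply: eq_bigr => v _.
rewrite /shift !degreeE big_ord_recl ffunE unlift_none /= addnA.
rewrite (eq_sym u) (eq_sym u'); congr (w v (_ + _)%N).
by apply: eq_bigr => e _; rewrite ffunE liftK.
Qed.

Lemma Delta_egf D : Delta D = egf (fun d => (d \in D)%:R).
Proof. by apply/fpsP => d /=; case: ifP; rewrite ?mul1r ?mul0r. Qed.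

Lemma count_degrees_in D n m :
  \sum_(G : multigraph n m | degrees_in D G) 1 =
  (2 * m)`!%:R * (Delta D ^+ n)`[2 * m] :> rat.
Proof.
have -> : Delta D ^+ n = \prod_(v < n) egf (fun d => (d \in D)%:R).
  by rewrite prodr_const card_ord Delta_egf.
rewrite -(@sum_multigraph_weight _ _ (fun _ d => (d \in D)%:R)) big_mkcond /=.
apply: eq_bigr => G _; rewrite /degrees_in; case: ifPn => [/forallP allD|].
  by rewrite big1 // => v _; rewrite allD.
by rewrite negb_forall => /existsP[v /negPf notD]; rewrite (bigD1 v) //= notD mul0r.
Qed.

Lemma Delta_quot_pow (D : set nat) n j : (forall d, D d -> (2 <= d)%N) ->
  (Delta_quot D ^+ n)`[j] = 2 ^+ n * (Delta D ^+ n)`[j + 2 * n].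
Proof.
move=> D_ge2; rewrite -(Delta_quotK D_ge2); move: (Delta_quot D) => Q.
rewrite exprMn exprZn -exprM -scalerAl fcoefZ fcoefXnM mulrA -exprMn.
by rewrite divff // expr1n mul1r.
Qed.

Lemma odd_dfactS k : odd_dfact k.+1 = (2 * k + 1)%:R * odd_dfact k.
Proof.
rewrite /odd_dfact mulnS !factS !natrM exprS; field.
by rewrite fact_neq0 nat1r natrS_neq0 expf_neq0.
Qed.

(** Passing from n to n+1 multiplies gbinom by (-(k + 1/2) - n) / (n+1), hence
    the left-hand side by (2(n + k) + 1) / (n+1), which is the factor by which
    (2(n + k) - 1)!! / n! grows. *)
Lemma odd_dfact_gbinom k n :
  odd_dfact k * ((-1) ^+ n * 2 ^+ n * gbinom (- (k%:R + 1 / 2)) n) =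
  odd_dfact (n + k) / n`!%:R.
Proof.
elim: n => [|n IHn].
  by rewrite /gbinom big_ord0 fact0 !expr0 !divr1 ?mulr1.
apply: (mulIf (natrS_neq0 n)).
transitivity ((2 * (n + k) + 1)%:R * (odd_dfact (n + k) / n`!%:R)).
  have := gbinomS (- (k%:R + 1 / 2)) n; rewrite -[LHS]mulr_natr => gbS.
  rewrite -IHn; move: (odd_dfact k) (gbinom _ n) (gbinom _ n.+1) gbS => c g g' gbS.
  (* Isolate the product to which gbS applies. *)
  transitivity (c * (-1) ^+ n.+1 * 2 ^+ n.+1 * (g' * n.+1%:R)); first by ring.
  by rewrite gbS !exprS; field.
rewrite addSn odd_dfactS factS natrM; field.
by rewrite fact_neq0 nat1r natrS_neq0.
Qed.

Theorem proposition1 (D : set nat) (D_ge2 : forall d : nat, D d -> (2 <= d)%N)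
    (k : nat) :
  mg_gf (degrees_in D) k =
  odd_dfact k *:
    coef_x (2 * k) (1 / fps_pow (1 - var_z * in_x (Delta_quot D))
                                (k%:R + 1 / 2)).
Proof.
have -> : 1 - var_z * in_x (Delta_quot D) = 1 + fpsX * (- Delta_quot D)%:A.
  by rewrite scaleNr mulrN.
rewrite fps_pow_linearN fps_pow_linear; apply/fpsP => n; rewrite fcoefZ.
transitivity (odd_dfact (n + k) / n`!%:R * (Delta D ^+ n)`[2 * (n + k)]).
  transitivity ((2 ^+ (n + k) * ((n + k)`!)%:R)^-1 * (n`!%:R)^-1 *
    \sum_(G : multigraph n (n + k) | degrees_in D G) 1 : rat).
    by rewrite mulr_sumr; apply: eq_bigr => G _; rewrite mulr1.
  by rewrite count_degrees_in /odd_dfact; ring.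
transitivity (odd_dfact k * (gbinom (- (k%:R + 1 / 2)) n *
    ((- Delta_quot D) ^+ n)`[2 * k])); last by [].
rewrite -scaleN1r exprZn fcoefZ Delta_quot_pow // -odd_dfact_gbinom.
by rewrite -mulnDr (addnC k); ring.
Qed.
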